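(* Let $K, M \ge 2$ be integers, $\mathcal{D} = \{0,1,\ldots,K-1\}$, $\mathcal{Y} = \{0,1,\ldots,M-1\}$, let $\mathcal{X}$ be a finite set, and let $\mathcal{Z} = \mathcal{D}\times\mathcal{Y}^{\mathcal{D}}\times\mathcal{X}$. Let $\succsim$ be a binary relation on $\Delta(\mathcal{Z})$. The following are equivalent: (1) $\succsim$ satisfies Completeness, Transitivity, Independence and Continuity; (2) there exists a counterfactual utility $\tilde u:\mathcal{Z}\to\mathbb{R}$ that represents $\succsim$. Moreover, any such utility function $\tilde u$ is unique up to a positive affine transformation, i.e. if $\tilde u$ and $\tilde v$ both represent $\succsim$, then there are $a>0$ and $b\in\mathbb{R}$ with $\tilde v = a\tilde u + b$.
   Context: $\Delta(S)$ denotes the set of probability measures on a finite set $S$. Elements of $\mathcal{Z}$ are written $(d,\mathbf{y},\mathbf{x})$ with $d\in\mathcal{D}$ (decision), $\mathbf{y}=(y_0,\ldots,y_{K-1})\in\mathcal{Y}^{\mathcal{D}}$ (potential outcomes) and $\mathbf{x}\in\mathcal{X}$ (covariates). A policy is a map $\pi:\mathcal{Y}^{\mathcal{D}}\times\mathcal{X}\to\Delta(\mathcal{D})$, and a state of nature is $P\in\Delta(\mathcal{Y}^{\mathcal{D}}\times\mathcal{X})$. The pair $(\pi,P)$ induces $P^\pi\in\Delta(\mathcal{Z})$ by $P^\pi(d,\mathbf{y},\mathbf{x})=\pi(d;\mathbf{y},\mathbf{x})P(\mathbf{y},\mathbf{x})$; every element of $\Delta(\mathcal{Z})$ is of this form.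 A counterfactual utility is a function $\tilde u:\mathcal{Z}\to\mathbb{R}$, and the value is $V_P(\pi;\tilde u)=\sum_{(d,\mathbf{y},\mathbf{x})\in\mathcal{Z}}\tilde u(d;\mathbf{y},\mathbf{x})P^\pi(d,\mathbf{y},\mathbf{x})$. The relation $\succsim$ is represented by $\tilde u$ if for all $P^\pi,Q^\rho\in\Delta(\mathcal{Z})$: $P^\pi\succsim Q^\rho \iff V_P(\pi;\tilde u)\ge V_Q(\rho;\tilde u)$ (equivalently, for all $p,q\in\Delta(\mathcal{Z})$: $p\succsim q\iff \sum_z\tilde u(z)p(z)\ge\sum_z\tilde u(z)q(z)$). Write $p\succ q$ if $p\succsim q$ but not $q\succsim p$. Mixtures are pointwise: $(\alpha p+(1-\alpha)q)(z)=\alpha p(z)+(1-\alpha)q(z)$. Axioms: Completeness: for all $p,q\in\Delta(\mathcal{Z})$, $p\succsim q$ or $q\succsim p$. Transitivity: for all $p,q,r\in\Delta(\mathcal{Z})$, if $p\succsim q$ and $q\succsim r$ then $p\succsim r$. Independence: for all $p,q,r\in\Delta(\mathcal{Z})$ and $\alpha\in(0,1]$, if $p\succ q$ then $\alpha p+(1-\alpha)r\succ\alpha q+(1-\alpha)r$. Continuity: for all $p,q,r\in\Delta(\mathcal{Z})$, if $p\succ q\succ r$ then there exist $\alpha,\beta\in(0,1)$ with $\alpha p+(1-\alpha)r\succ q\succ\beta p+(1-\beta)r$. *)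

(* Defs.v *)
From HB Require Import structures.
From mathcomp Require Import all_boot all_order all_algebra.
From mathcomp Require Import interval_inference reals.

Set Implicit Arguments.
Unset Strict Implicit.
Unset Printing Implicit Defensive.

Import Order.TTheory GRing.Theory Num.Theory.
Local Open Scope ring_scope.

Section Distributions.
Variables (R : realType) (S : finType).

(* Mass functions are finite functions and the side conditions are boolean, so
   pointwise equal probability measures are Leibniz equal; a relation on [dist]
   therefore depends on the measures only.  [dist] is empty when [S] is. *)
Record dist := Dist {
  pmf :> {ffun S -> R};
  _ : [forall s, 0 <= pmf s] && (\sum_s pmf s == 1) }.

HB.instance Definition _ := [isSub for pmf].

Lemma dist_ge0 (p : dist) s : 0 <= p s.
Proof. by have /andP[/forallP/(_ s)] := valP p. Qed.

Lemma dist_sum1 (p : dist) : \sum_s p s = 1.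
Proof. by have /andP[_ /eqP] := valP p. Qed.

Lemma eq_dist (p q : dist) : p =1 q -> p = q.
Proof. by move=> epq; apply/val_inj/ffunP. Qed.

Lemma mix_subproof (a : {i01 R}) (p q : dist) :
  let m := [ffun s => a%:num * p s + (1 - a%:num) * q s] in
  [forall s, 0 <= m s] && (\sum_s m s == 1).
Proof.
apply/andP; split.
  by apply/forallP => s; rewrite ffunE addr_ge0 ?mulr_ge0 ?dist_ge0.
under eq_bigr do rewrite ffunE.
by rewrite big_split/= -!mulr_sumr !dist_sum1 !mulr1 addrC subrK.
Qed.

Definition mix (a : {i01 R}) (p q : dist) : dist := Dist (mix_subproof a p q).

Variable pref : dist -> dist -> Prop.

Definition strict (p q : dist) : Prop := pref p q /\ ~ pref q p.

Definition completeness : Prop := forall p q : dist, pref p q \/ pref q p.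

Definition transitivity : Prop :=
  forall p q r : dist, pref p q -> pref q r -> pref p r.

Definition independence : Prop :=
  forall (p q r : dist) (a : {i01 R}), 0 < a%:num ->
    strict p q -> strict (mix a p r) (mix a q r).

Definition continuity : Prop :=
  forall p q r : dist, strict p q -> strict q r ->
    exists a b : {i01 R},
      [/\ 0 < a%:num < 1, 0 < b%:num < 1,
          strict (mix a p r) q & strict q (mix b p r)].

End Distributions.

Section Decisions.
Variables (R : realType) (K M : nat) (X : finType).

Definition decision : finType := 'I_K.

Definition outcome : finType := 'I_M.

(* The pairs (y, x) of potential outcomes and covariates. *)
Definition context : finType := ({ffun decision -> outcome} * X)%type.

(* The triples (d, y, x), bracketed as (d, (y, x)). *)
Definition alternative : finType := (decision * context)%type.

Definition policy : Type := context -> dist R decision.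

Definition state : Type := dist R context.

Definition utility : Type := alternative -> R.

Lemma induced_subproof (P : state) (pi : policy) :
  let m := [ffun z : alternative => pi z.2 z.1 * P z.2] in
  [forall z, 0 <= m z] && (\sum_z m z == 1).
Proof.
apply/andP; split.
  by apply/forallP => z; rewrite ffunE mulr_ge0 ?dist_ge0.
under eq_bigr do rewrite ffunE.
rewrite -(pair_bigA _ (fun d c => pi c d * P c))/= exchange_big/=.
under eq_bigr do rewrite -mulr_suml dist_sum1 mul1r.
by rewrite dist_sum1.
Qed.

Definition induced (P : state) (pi : policy) : dist R alternative :=
  Dist (induced_subproof P pi).

Definition value (P : state) (pi : policy) (u : utility) : R :=
  \sum_(z : alternative) u z * induced P pi z.

Definition represents (u : utility)
    (pref : dist R alternative -> dist R alternative -> Prop) : Prop :=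
  forall (P Q : state) (pi rho : policy),
    pref (induced P pi) (induced Q rho) <-> value Q rho u <= value P pi u.

(* [represents] constrains the relation on all pairs of measures. *)
Lemma induced_surj (p : dist R alternative) :
  (0 < K)%N -> exists P pi, p = induced P pi.
Proof.
move=> K_gt0.
pose marg := [ffun c : context => \sum_d p (d, c)].
have margP : [forall c, 0 <= marg c] && (\sum_c marg c == 1).
  apply/andP; split.
    by apply/forallP => c; rewrite ffunE sumr_ge0// => d _; exact: dist_ge0.
  under eq_bigr do rewrite ffunE.
  rewrite exchange_big/= pair_bigA/=; apply/eqP.
  by rewrite -[RHS](dist_sum1 p); apply: eq_bigr => -[].
pose cnd0 c d : R :=
  if marg c == 0 then (d == Ordinal K_gt0)%:R else p (d, c) / marg c.
pose cnd (c : context) := [ffun d : decision => cnd0 c d].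
have marg_ge0 c : 0 <= marg c by have /andP[/forallP/(_ c)] := margP.
have cndP c : [forall d, 0 <= cnd c d] && (\sum_d cnd c d == 1).
  apply/andP; split.
    apply/forallP => d; rewrite ffunE /cnd0; case: ifP => _; first exact: ler0n.
    by rewrite divr_ge0 ?dist_ge0.
  under eq_bigr do rewrite ffunE /cnd0.
  have [m0|m0] := eqVneq (marg c) 0.
    rewrite (bigD1 (Ordinal K_gt0))// big1 => [|d /negbTE -> //].
    by rewrite eqxx; apply/eqP; exact: addr0.
  rewrite -mulr_suml (_ : \sum_d p (d, c) = marg c) ?divff//.
  by rewrite ffunE.
exists (Dist margP), (fun c => Dist (cndP c)).
apply: eq_dist => -[d c]; rewrite [RHS]ffunE/= [cnd c d]ffunE /cnd0.
have [m0|m0] := eqVneq (marg c) 0; last by rewrite divfK.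
rewrite m0 mulr0; move: m0; rewrite ffunE => /eqP.
rewrite psumr_eq0; last by move=> d' _; exact: dist_ge0.
by move=> /allP/(_ d (mem_index_enum _))/eqP.
Qed.

End Decisions.

(* Main.v *)
(* The von Neumann-Morgenstern argument.  Continuity and a supremum show that
   every lottery lying between two lotteries is indifferent to a mixture of
   them, and Independence and Continuity together show that mixing preserves
   indifference.  Calibrating each Dirac measure against the mixtures of a best
   and a worst Dirac measure gives the utility; since every measure is obtained
   from Dirac measures by mixing, every measure is then calibrated by its
   expected utility.  Uniqueness follows by comparing each Dirac measure with the
   mixture of the extremal ones that has the same utility. *)
Require Import Defs.
From mathcomp Require Import all_boot all_order all_algebra.
From mathcomp Require Import interval_inference boolp classical_sets reals.
From mathcomp Require Import ring lra.

Set Implicit Arguments.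
Unset Strict Implicit.
Unset Printing Implicit Defensive.

Import Order.TTheory GRing.Theory Num.Theory.
Local Open Scope ring_scope.

(** * Weights and extremal elements *)

Lemma i01_ex (R : realType) (x : R) :
  0 <= x -> x <= 1 -> exists a : {i01 R}, a%:num = x.
Proof. by move=> x0 x1; exists (Itv01 x0 x1). Qed.

(** The relation is [Prop]-valued so that it can be a preference between Dirac measures; reversing
    it yields a least element. *)
Lemma finite_greatest (T : finType) (le : T -> T -> Prop) (t0 : T) :
  (forall x y, le x y \/ le y x) ->
  (forall x y z, le x y -> le y z -> le x z) ->
  exists m, forall x, le x m.
Proof.
move=> le_total le_trans.
suff [m mP] : exists m, forall x, x \in enum T -> le x m.
  by exists m => x; apply: mP; rewrite mem_enum.
elim: (enum T) => [|y s [m mP]]; first by exists t0.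
have [ym|my] := le_total y m.
  by exists m => x; rewrite inE => /orP[/eqP ->|/mP].
exists y => x; rewrite inE => /orP[/eqP ->|/mP xm]; last exact: le_trans my.
by have [] := le_total y y.
Qed.

(** * Mixtures, Dirac measures and expectations *)

Section Mixtures.
Variables (R : realType) (S : finType).
Implicit Types (p q : dist R S) (a b : {i01 R}) (u : S -> R).

Lemma mixE a p q s : mix a p q s = a%:num * p s + (1 - a%:num) * q s.
Proof. by rewrite ffunE. Qed.

Lemma mixpp a p : mix a p p = p.
Proof. by apply: eq_dist => s; rewrite mixE; ring. Qed.

Lemma mix1 a p q : a%:num = 1 -> mix a p q = p.
Proof. by move=> a1; apply: eq_dist => s; rewrite mixE a1; ring. Qed.

Lemma mix0 a p q : a%:num = 0 -> mix a p q = q.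
Proof. by move=> a0; apply: eq_dist => s; rewrite mixE a0; ring. Qed.

Lemma mixC a b p q : b%:num = 1 - a%:num -> mix a p q = mix b q p.
Proof. by move=> ab; apply: eq_dist => s; rewrite !mixE ab; ring. Qed.

Lemma mix_interchange a b p q r :
  mix b (mix a p r) (mix a q r) = mix a (mix b p q) r.
Proof. by apply: eq_dist => s; rewrite !mixE; ring. Qed.

Lemma dirac_subproof (s : S) :
  let m := [ffun t => (t == s)%:R : R] in
  [forall t, 0 <= m t] && (\sum_t m t == 1).
Proof.
apply/andP; split; first by apply/forallP => t; rewrite ffunE ler0n.
rewrite (bigD1 s)//= big1 => [|t /negbTE ts]; last by rewrite ffunE ts.
by rewrite ffunE eqxx addr0.
Qed.

Definition dirac (s : S) : dist R S := Dist (dirac_subproof s).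

Lemma diracE s t : dirac s t = (t == s)%:R.
Proof. by rewrite ffunE. Qed.

Lemma dist_inhabited p : exists s, p s != 0.
Proof.
apply: contrapT => p0; have := dist_sum1 p; rewrite big1 => [|s _].
  by move/eqP; rewrite eq_sym oner_eq0.
by apply: contrapT => /eqP ps; apply: p0; exists s.
Qed.

Lemma dist_sumD1 p s : \sum_(t | t != s) p t = 1 - p s.
Proof.
by rewrite -(dist_sum1 p) [in RHS](bigD1 s)//= [RHS]addrAC subrr add0r.
Qed.

Lemma dist_le1 p s : p s <= 1.
Proof.
by rewrite -subr_ge0 -dist_sumD1 sumr_ge0// => t _; exact: dist_ge0.
Qed.

Lemma dist_eq1 p s : p s = 1 -> p = dirac s.
Proof.
move=> ps1; apply: eq_dist => t; rewrite diracE.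
have [->//|ts] := eqVneq t s.
have := dist_sumD1 p s; rewrite ps1 subrr => /eqP.
rewrite psumr_eq0; last by move=> i _; exact: dist_ge0.
by move=> /allP/(_ t (mem_index_enum _)); rewrite ts => /eqP.
Qed.

(** This is [p] conditioned on the complement of [s], which has positive mass by hypothesis. *)
Lemma cond_subproof p s : p s != 1 ->
  let m := [ffun t => if t == s then 0 else p t / (1 - p s)] in
  [forall t, 0 <= m t] && (\sum_t m t == 1).
Proof.
move=> ps1; apply/andP; split.
  apply/forallP => t; rewrite ffunE; case: ifP => // _.
  by rewrite divr_ge0 ?dist_ge0// subr_ge0 dist_le1.
rewrite (bigD1 s)//= ffunE eqxx add0r.
rewrite (eq_bigr (fun t => p t / (1 - p s))); last first.
  by move=> t /negbTE ts; rewrite ffunE ts.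
by rewrite -mulr_suml dist_sumD1 divff// subr_eq0 eq_sym.
Qed.

(** Induction on the size of the support: unless [p] is a Dirac measure, it is the mixture, with
    weight [p s], of the Dirac measure at a support point [s] and of [p] conditioned on the
    complement of [s], whose support is smaller. *)
Lemma dist_mix_ind (P : dist R S -> Prop) :
  (forall s, P (dirac s)) -> (forall a p q, P p -> P q -> P (mix a p q)) ->
  forall p, P p.
Proof.
move=> Pdirac Pmix p.
have [n] := ubnP #|[set s | p s != 0]|; elim: n p => // n IH p suppn.
have [s ps0] := dist_inhabited p.
have [/dist_eq1 -> //|ps1] := eqVneq (p s) 1.
pose q := Dist (cond_subproof ps1).
have qE t : q t = if t == s then 0 else p t / (1 - p s) by rewrite ffunE.
have [a aE] := i01_ex (dist_ge0 p s) (dist_le1 p s).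
have -> : p = mix a (dirac s) q.
  apply: eq_dist => t; rewrite mixE aE diracE qE.
  have [->|ts] := eqVneq t s; first by rewrite mulr1 mulr0 addr0.
  by rewrite mulr0 add0r mulrC divfK// subr_eq0 eq_sym.
apply: Pmix => //; apply: IH; rewrite -ltnS (leq_trans _ suppn)// ltnS.
apply/proper_card/properP; split.
  apply/fintype.subsetP => t; rewrite !inE qE; case: ifP; first by rewrite eqxx.
  by move=> _; apply: contraNneq => ->; rewrite mul0r.
by exists s; rewrite !inE ?qE ?eqxx.
Qed.

Definition expect u p : R := \sum_s u s * p s.

Lemma expect_mix u a p q :
  expect u (mix a p q) = a%:num * expect u p + (1 - a%:num) * expect u q.
Proof.
rewrite /expect !mulr_sumr -big_split/=.
by apply: eq_bigr => s _; rewrite mixE; ring.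
Qed.

Lemma expect_dirac u s : expect u (dirac s) = u s.
Proof.
rewrite /expect (bigD1 s)//= big1 => [|t /negbTE ts]; rewrite diracE ?ts.
  by rewrite eqxx mulr1 addr0.
by rewrite mulr0.
Qed.

End Mixtures.

(** * From a utility to the axioms, and uniqueness *)

Section ExpectedUtility.
Variables (R : realType) (S : finType).
Variable pref : dist R S -> dist R S -> Prop.
Implicit Types (p q r : dist R S) (a b : {i01 R}) (u v : S -> R).

(** The notion is stated on arbitrary measures over a finite type, so that the argument can ignore
    policies and states of nature until the end. *)
Definition expected_utility u : Prop :=
  forall p q, pref p q <-> expect u q <= expect u p.

Lemma expected_utility_strict u p q :
  expected_utility u -> strict pref p q <-> expect u q < expect u p.
Proof.
move=> uP; rewrite /strict !uP; split=> [[_ /negP]|qp]; first by rewrite -ltNge.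
by split; [exact: ltW | apply/negP; rewrite -ltNge].
Qed.

Lemma expected_utility_axioms u : expected_utility u ->
  [/\ completeness pref, transitivity pref, independence pref
    & continuity pref].
Proof.
move=> uP; split.
- by move=> p q; rewrite !uP; apply/orP/le_total.
- by move=> p q r; rewrite !uP => qp rq; exact: le_trans rq qp.
- move=> p q r a a0; rewrite !(expected_utility_strict _ _ uP) !expect_mix.
  by move=> qp; rewrite ltrD2r ltr_pM2l.
- move=> p q r; rewrite !(expected_utility_strict _ _ uP) => qp rq.
  set x := expect u p in qp *; set y := expect u q in qp rq *.
  set z := expect u r in rq *.
  have xz : 0 < x - z by lra.
  (* At weight [c] the mixture of [p] and [r] has exactly the utility of [q]; the midpoints of
     [[c, 1]] and [[0, c]] therefore lie strictly on either side. *)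
  pose c := (y - z) / (x - z).
  have cE : c * (x - z) = y - z by rewrite divfK// gt_eqF.
  have c0 : 0 < c by rewrite divr_gt0// subr_gt0.
  have c1 : c < 1 by rewrite ltr_pdivrMr//; lra.
  have [a aE] : exists a : {i01 R}, a%:num = (1 + c) / 2 by apply: i01_ex; lra.
  have [b bE] : exists b : {i01 R}, b%:num = c / 2 by apply: i01_ex; lra.
  exists a, b.
  split; rewrite ?(expected_utility_strict _ _ uP) ?expect_mix ?aE ?bE.
  - lra.
  - lra.
  - rewrite -/x -/y -/z.
    have : 0 < (1 - c) * (x - z) by rewrite mulr_gt0// subr_gt0.
    nra.
  - rewrite -/x -/y -/z.
    have : 0 < c * (x - z) by rewrite mulr_gt0.
    nra.
Qed.

Lemma expected_utility_unique u v :
  expected_utility u -> expected_utility v ->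
  exists a b : R, 0 < a /\ forall s, v s = a * u s + b.
Proof.
move=> uP vP.
(* Equal [u]-expectations mean indifference, which [v] must also reflect. *)
have uvE p q : expect u p = expect u q -> expect v p = expect v q.
  move=> pq; apply/le_anti/andP.
  by split; apply/vP/uP; rewrite pq.
case: (pickP [pred _ : S | true]) => [s0 _|S0]; last first.
  by exists 1, 0; split=> // s; have := S0 s.
have [h hP] : exists h, forall s, u s <= u h.
  apply: finite_greatest s0 _ _ => [x y|x y z]; last exact: le_trans.
  exact/orP/le_total.
have [l lP] : exists l, forall s, u l <= u s.
  apply: (finite_greatest (le := fun x y => u y <= u x) s0) => [x y|x y z].
    exact/orP/le_total.
  by move=> yx zy; exact: le_trans zy yx.
(* If the extremes coincide, [u] and hence [v] are constant, and a translation suffices. *)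
have [hl|hl] := leP (u h) (u l).
  exists 1, (v h - u h); split=> // s.
  have us : u s = u h by apply/le_anti; rewrite hP (le_trans hl (lP s)).
  suff -> : v s = v h by rewrite us; ring.
  rewrite -(expect_dirac v s) -(expect_dirac v h).
  by apply: uvE; rewrite !expect_dirac.
have d0 : 0 < u h - u l by rewrite subr_gt0.
have vhl : v l < v h.
  rewrite -(expect_dirac v l) -(expect_dirac v h).
  apply/(expected_utility_strict _ _ vP)/(expected_utility_strict _ _ uP).
  by rewrite !expect_dirac.
(* The slope and the intercept are forced by the values at [h] and [l]. *)
pose a := (v h - v l) / (u h - u l).
exists a, (v l - a * u l); split; first by rewrite divr_gt0// subr_gt0.
(* The weight on [h] at which the mixture with [l] has utility [u s]. *)
move=> s; pose t := (u s - u l) / (u h - u l).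
have [c cE] : exists c : {i01 R}, c%:num = t.
  apply: i01_ex; first by rewrite divr_ge0 ?subr_ge0// ltW.
  by rewrite ler_pdivrMr// mul1r lerD2r.
have dn0 : u h - u l != 0 by rewrite gt_eqF.
have : expect u (dirac R s) = expect u (mix c (dirac R h) (dirac R l)).
  by rewrite expect_mix !expect_dirac cE /t; field.
move=> /uvE; rewrite expect_mix !expect_dirac cE => ->.
by rewrite /t /a; field.
Qed.

(** * From the axioms to a utility *)

Hypothesis pref_total : completeness pref.
Hypothesis pref_trans : transitivity pref.

Let indiff p q := pref p q /\ pref q p.

Lemma pref_refl p : pref p p.
Proof. by have [] := pref_total p p. Qed.

Lemma not_pref p q : ~ pref p q -> strict pref q p.
Proof. by move=> npq; split=> //; have [] := pref_total p q. Qed.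

Lemma pref_strict_trans p q r :
  pref p q -> strict pref q r -> strict pref p r.
Proof.
move=> pq [qr nrq]; split; first exact: pref_trans qr.
by move=> rp; apply: nrq; exact: pref_trans rp pq.
Qed.

Lemma strict_pref_trans p q r :
  strict pref p q -> pref q r -> strict pref p r.
Proof.
move=> [pq nqp] qr; split; first exact: pref_trans qr.
by move=> rp; apply: nqp; exact: pref_trans qr rp.
Qed.

Lemma strict_trans p q r :
  strict pref p q -> strict pref q r -> strict pref p r.
Proof. by move=> pq [qr _]; exact: strict_pref_trans qr. Qed.

Hypothesis pref_indep : independence pref.

(** Independence is used twice: first to place [mix a p q] strictly above [q], then to see that
    moving [mix a p q] towards [q] makes it worse. Weight [1 - b / a] on [q] turns it into
    [mix b p q]. *)
Lemma strict_mix_lt p q a b :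
  strict pref p q -> b%:num < a%:num -> strict pref (mix a p q) (mix b p q).
Proof.
move=> pq ba.
have a0 : 0 < a%:num by apply: le_lt_trans ba.
have bge0 : 0 <= b%:num by [].
have /pref_indep mq := pref_indep q a0 pq; rewrite mixpp in mq.
pose c0 := 1 - b%:num / a%:num.
have c0_gt0 : 0 < c0 by rewrite subr_gt0 ltr_pdivrMr// mul1r.
have [c cE] : exists c : {i01 R}, c%:num = c0.
  apply: i01_ex; first exact: ltW.
  by rewrite gerBl divr_ge0.
have := mq (mix a p q) c; rewrite mixpp cE => /(_ c0_gt0).
suff -> : mix c q (mix a p q) = mix b p q by [].
have an0 : a%:num != 0 by rewrite gt_eqF.
by apply: eq_dist => s; rewrite !mixE cE /c0; field.
Qed.

Lemma pref_mix_le p q a b :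
  strict pref p q -> pref (mix a p q) (mix b p q) <-> b%:num <= a%:num.
Proof.
move=> pq; split=> [ab|].
  by rewrite leNgt; apply/negP => /(strict_mix_lt pq)[].
rewrite le_eqVlt => /orP[/eqP ab|/(strict_mix_lt pq)[]//].
suff -> : mix b p q = mix a p q by exact: pref_refl.
by apply: eq_dist => s; rewrite !mixE ab.
Qed.

Hypothesis pref_cont : continuity pref.

Lemma indiff_mix_ex p q r : strict pref p r -> pref p q -> pref q r ->
  exists a, indiff q (mix a p r).
Proof.
move=> pr pq qr.
have [one oneE] := @i01_ex R 1 ler01 (lexx 1).
have [zero zeroE] := @i01_ex R 0 (lexx 0) ler01.
(* Indifference to an endpoint is settled by weight 1 or 0, which leaves [q] strictly between [p]
   and [r], as Continuity requires. *)
have [qp|/not_pref {}pq] := EM (pref q p); first by exists one; rewrite mix1.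
have [rq|/not_pref {}qr] := EM (pref r q); first by exists zero; rewrite mix0.
(* The supremum of the weights whose mixture is no better than [q] is the calibrating weight. *)
pose E : set R :=
  fun x => exists2 a : {i01 R}, a%:num = x & pref q (mix a p r).
have E0 : E 0 by exists zero => //; rewrite mix0//; case: qr.
have ubE : ubound E 1 by move=> x [a <- _].
have supE : has_sup E by split; [exists 0 | exists 1].
have sup_ge0 : 0 <= sup E by apply: (ub_le_sup _ E0); exists 1.
have [a aE] := i01_ex sup_ge0 (ge_sup (ex_intro _ 0 E0) ubE).
exists a; split; apply: contrapT => /not_pref strict_q.
(* If the mixture at the supremum beat [q], so would one of smaller weight [b * a]; but some element
   of [E] exceeds that weight. *)
- have [b [_ [/andP[b0 b1] _ bq _]]] := pref_cont strict_q qr.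
  have a0 : 0 < a%:num.
    rewrite lt_neqAle eq_sym; apply/andP; split=> //; apply/negP => /eqP a0.
    by rewrite (mix0 _ _ a0) in strict_q; case: strict_q => _; apply; case: qr.
  have [c cE] : exists c : {i01 R}, c%:num = b%:num * a%:num.
    by apply: i01_ex; rewrite ?mulr_ge0 ?mulr_ile1.
  have bqE : mix b (mix a p r) r = mix c p r.
    by apply: eq_dist => s; rewrite !mixE cE; ring.
  rewrite bqE in bq.
  have ca : 0 < sup E - c%:num by rewrite -aE cE; nra.
  have [x [d dE qd]] := sup_adherent ca supE.
  rewrite -dE subKr => /(strict_mix_lt pr) dc.
  by case: (strict_trans dc bq) => _.
(* If [q] beat that mixture, it would also beat one of larger weight, which would then be an element
   of [E] above its supremum. *)
- have [_ [b [_ /andP[b0 b1] _ qb]]] := pref_cont pq strict_q.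
  have a1 : a%:num < 1.
    rewrite lt_neqAle; apply/andP; split=> //; apply/negP => /eqP a1.
    by rewrite (mix1 _ _ a1) in strict_q; case: strict_q => _; apply; case: pq.
  have a0 : 0 <= a%:num by [].
  have [c cE] : exists c : {i01 R}, c%:num = b%:num + (1 - b%:num) * a%:num.
    by apply: i01_ex; nra.
  have qbE : mix b p (mix a p r) = mix c p r.
    by apply: eq_dist => s; rewrite !mixE cE; ring.
  have : c%:num <= sup E.
    apply: ub_le_sup; first by exists 1.
    by exists c => //; rewrite -qbE; case: qb.
  by rewrite -aE cE; nra.
Qed.

(* A strict preference between the two mixtures yields a lottery [s] strictly
   better or strictly worse than [p] and [q]; moving [q] towards [s] in the
   worse mixture (or [p] in the better one), however slightly, would have to
   reverse that preference, against continuity. *)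
Lemma indiff_mixl_not_strict p q r a : 0 < a%:num -> indiff p q ->
  ~ strict pref (mix a p r) (mix a q r).
Proof.
move=> a0 [pq qp] pq_mix.
have [pr|/not_pref sp] := EM (pref p (mix a p r)).
- set s := mix a q r in pq_mix.
  have ps : strict pref p s := pref_strict_trans pr pq_mix.
  have qs : strict pref q s := pref_strict_trans qp ps.
  have [b [_ [/andP[_ b1] _ bq _]]] :=
    pref_cont pq_mix (pref_indep r a0 qs).
  rewrite mix_interchange in bq.
  have [c cE] : exists c : {i01 R}, c%:num = 1 - b%:num.
    by apply: i01_ex; rewrite ?subr_ge0 ?gerBl.
  have c0 : 0 < c%:num by rewrite cE subr_gt0.
  have := pref_indep p c0 ps; rewrite mixpp -(mixC _ _ cE).
  by move=> /(pref_strict_trans qp)/(pref_indep r a0)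
    /(strict_trans bq)[ss /(_ ss)].
- set s := mix a p r in pq_mix sp.
  have sq : strict pref s q := strict_pref_trans sp pq.
  have [_ [b [_ /andP[b0 _] _ pb]]] :=
    pref_cont (pref_indep r a0 sp) pq_mix.
  rewrite mix_interchange in pb.
  have := pref_indep q b0 sq; rewrite mixpp.
  by move=> /strict_pref_trans/(_ qp)/(pref_indep r a0)
    /(strict_trans pb)[ss /(_ ss)].
Qed.

(** The weak form of Independence: the strict case is the axiom, and the indifferent case is
    [indiff_mixl_not_strict]. *)
Lemma pref_mixl p q r a : pref p q -> pref (mix a p r) (mix a q r).
Proof.
move=> pq.
have [a0|a0] := eqVneq a%:num 0; first by rewrite !mix0//; exact: pref_refl.
have {}a0 : 0 < a%:num by rewrite lt_neqAle eq_sym a0/=.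
have [qp|/not_pref {}pq] := EM (pref q p); last by case: (pref_indep r a0 pq).
apply: contrapT => /not_pref; exact: indiff_mixl_not_strict.
Qed.

Lemma pref_mix p q p' q' a :
  pref p p' -> pref q q' -> pref (mix a p q) (mix a p' q').
Proof.
move=> pp' qq'; apply: pref_trans (pref_mixl q a pp') _.
have [c cE] : exists c : {i01 R}, c%:num = 1 - a%:num.
  by apply: i01_ex; rewrite ?subr_ge0 ?gerBl.
by rewrite !(mixC _ _ cE); exact: pref_mixl.
Qed.

(** A mixture of two mixtures of [h] and [l] is again one, with the mixed weight, and expectation is
    affine in the same way; so [dist_mix_ind] extends the calibration from Dirac measures. *)
Lemma indiff_expect u h l :
  (forall s, exists2 a, u s = a%:num & indiff (dirac R s) (mix a h l)) ->
  forall p, exists2 a, expect u p = a%:num & indiff p (mix a h l).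
Proof.
move=> uP; apply: dist_mix_ind => [s|a p q [b bE [pb bp]] [c cE [qc cq]]].
  by have [a aE ?] := uP s; exists a; rewrite ?expect_dirac.
have [d dE] : exists d : {i01 R},
    d%:num = a%:num * b%:num + (1 - a%:num) * c%:num.
  have [a0 a1] : 0 <= a%:num /\ a%:num <= 1 by [].
  have [b0 b1] : 0 <= b%:num /\ b%:num <= 1 by [].
  have [c0 c1] : 0 <= c%:num /\ c%:num <= 1 by [].
  by apply: i01_ex; nra.
exists d; first by rewrite expect_mix bE cE.
have -> : mix d h l = mix a (mix b h l) (mix c h l).
  by apply: eq_dist => s; rewrite !mixE dE; ring.
by split; apply: pref_mix.
Qed.

Lemma expected_utility_ex : exists u, expected_utility u.
Proof.
(* On an empty [S] there are no measures to compare. *)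
case: (pickP [pred _ : S | true]) => [s0 _|S0]; last first.
  by exists (fun=> 0) => p; have [s] := dist_inhabited p; have := S0 s.
have [h hP] : exists h, forall s, pref (dirac R h) (dirac R s).
  apply: (finite_greatest (le := fun x y => pref (dirac R y) (dirac R x)) s0).
    by move=> x y; exact: pref_total.
  by move=> x y z yx zy; exact: pref_trans zy yx.
have [l lP] : exists l, forall s, pref (dirac R s) (dirac R l).
  apply: (finite_greatest (le := fun x y => pref (dirac R x) (dirac R y)) s0).
    by move=> x y; exact: pref_total.
  by move=> x y z; exact: pref_trans.
(* If the best and the worst Dirac measures are indifferent, then so are all measures, and the zero
   utility represents the relation. *)
have [lh|/not_pref hl] := EM (pref (dirac R l) (dirac R h)).
  have all_indiff : forall p, indiff p (dirac R l).
    apply: dist_mix_ind => [s|a p q [pl lp] [ql lq]].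
      by split=> //; exact: pref_trans lh (hP s).
    by rewrite -(mixpp a (dirac R l)); split; apply: pref_mix.
  exists (fun=> 0) => p q.
  have [pl _] := all_indiff p; have [_ lq] := all_indiff q.
  rewrite /expect !big1 ?lexx => [|s _|s _]; rewrite ?mul0r//.
  by split=> // _; exact: pref_trans pl lq.
have /choice[f fP] s := indiff_mix_ex hl (hP s) (lP s).
exists (fun s => (f s)%:num) => p q.
have fE s : exists2 a : {i01 R}, (f s)%:num = a%:num
    & indiff (dirac R s) (mix a (dirac R h) (dirac R l)) by exists (f s).
have [a -> [pa ap]] := indiff_expect fE p.
have [b -> [qb bq]] := indiff_expect fE q.
rewrite -(pref_mix_le a b hl); split=> [pq|ab].
  exact: pref_trans ap (pref_trans pq qb).
exact: pref_trans pa (pref_trans ab bq).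
Qed.

End ExpectedUtility.

(** * Transfer to policies and states of nature *)

Lemma represents_expected_utility (R : realType) (K M : nat) (X : finType)
    (pref : dist R (alternative K M X) -> dist R (alternative K M X) -> Prop)
    (u : utility R K M X) :
  (0 < K)%N -> represents u pref <-> expected_utility pref u.
Proof.
move=> K_gt0; split=> uP; last by move=> P Q pi rho; exact: uP.
move=> p q; have [P [pi ->]] := induced_surj p K_gt0.
by have [Q [rho ->]] := induced_surj q K_gt0; exact: uP.
Qed.

Theorem theorem1 (R : realType) (K M : nat) (X : finType)
    (hK : (2 <= K)%N) (hM : (2 <= M)%N)
    (pref : dist R (alternative K M X) -> dist R (alternative K M X) -> Prop) :
  ([/\ completeness pref, transitivity pref, independence pref
     & continuity pref]
   <-> exists u : utility R K M X, represents u pref) /\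
  (forall u v : utility R K M X, represents u pref -> represents v pref ->
     exists a b : R, 0 < a /\ forall z, v z = a * u z + b).
Proof.
have reprE u := represents_expected_utility pref u (ltnW hK).
split; last by move=> u v /reprE uP /reprE; exact: expected_utility_unique.
split=> [[total trans indep cont]|[u /reprE]]; last first.
  exact: expected_utility_axioms.
have [u uP] := expected_utility_ex total trans indep cont.
by exists u; apply/reprE.
Qed.
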